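(* Every judgement $\{P\}\,c\,\{P'\}$ derivable in the proof system $\mathcal S_a$ is valid, i.e. for every POVD $\mu$ with $\mu\models P$ we have $[\![c]\!]_\mu\models P'$.
   Context: Language QIMP: commands $c::=\mathbf{skip}\mid\mathbf{abort}\mid x:=a\mid c_0;c_1\mid\mathbf{if}\ b\ \mathbf{then}\ c_0\ \mathbf{else}\ c_1\mid\mathbf{while}\ b\ \mathbf{do}\ c\mid q:=|0\rangle\mid U[\bar q]\mid x:=M[\bar q]$, with integer arithmetic expressions $a$ over classical variables, boolean expressions $b$ (true, false, comparisons $a_0=a_1$, $a_0\le a_1$, $\neg,\wedge,\vee$), qubit variables $q$, a unitary $U$ on qubits $\bar q$, and a measurement $M=\{M_i\}_{i\in I}$, $I\subseteq\mathbb Z$, on $\bar q$. Fix a finite set $V$ of qubit variables, $\mathcal H_V=\bigotimes_{q\in V}\mathbb C^2$. Classical states $\sigma$ map classical variables to $\mathbb Z$. A POVD is a map $\mu$ from classical states to positive operators on $\mathcal H_V$ with $\sum_\sigma\mathrm{tr}\,\mu(\sigma)\le1$; $\mathrm{supp}\,\mu=\{\sigma:\mu(\sigma)\neq0\}$; sums are pointwise; $(\sigma,\rho)$ is the POVD concentrated at $\sigma$ with value $\rho$; $\varepsilon$ is the zero POVD; increasing sequences (pointwise Löwner order) have limits. Denotational semantics $[\![c]\!]_{(\sigma,\rho)}$: $\mathbf{skip}\mapsto(\sigma,\rho)$; $\mathbf{abort}\mapsto\varepsilon$; $x:=a\mapsto(\sigma[[\![a]\!]_\sigma/x],\rho)$;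 $c_0;c_1\mapsto[\![c_1]\!]_{[\![c_0]\!]_{(\sigma,\rho)}}$; conditional selects $c_0$ or $c_1$ according to $[\![b]\!]_\sigma$; $\mathbf{while}\ b\ \mathbf{do}\ c\mapsto\lim_n[\![(\mathbf{if}\ b\ \mathbf{then}\ c)^n;\mathbf{if}\ b\ \mathbf{then}\ \mathbf{abort}]\!]_{(\sigma,\rho)}$ (where $\mathbf{if}\ b\ \mathbf{then}\ c$ means $\mathbf{if}\ b\ \mathbf{then}\ c\ \mathbf{else}\ \mathbf{skip}$, $c^n$ is $n$-fold iteration, $c^0=\mathbf{skip}$); $q:=|0\rangle\mapsto(\sigma,|0\rangle_q\langle0|\rho|0\rangle_q\langle0|+|0\rangle_q\langle1|\rho|1\rangle_q\langle0|)$; $U[\bar q]\mapsto(\sigma,U\rho U^\dagger)$; $x:=M[\bar q]\mapsto\mu$ with $\mu(\sigma')=\sum_i\{M_i\rho M_i^\dagger\mid\sigma[i/x]=\sigma'\}$; and $[\![c]\!]_\mu=\sum_{\sigma\in\mathrm{supp}\,\mu}[\![c]\!]_{(\sigma,\mu(\sigma))}$. $[\![c]\!]$ also denotes the function $\mu\mapsto[\![c]\!]_\mu$. Assertions: an assertion is a set of POVDs, $\mu\models P$ iff $\mu\in P$; $\mathbf{true}$ is the set of all POVDs and $\mathbf{false}=\emptyset$; $P\Rightarrow Q$ means $P\subseteq Q$. Constructors: $\mathbf 1_\mu=\{\mu\}$; $\neg P$ (complement); $P_1\wedge P_2$ (intersection); for a state predicate $\psi$ (e.g. a boolean expression), $\mu\models\Box\psi$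 iff $\psi$ holds at every $\sigma\in\mathrm{supp}\,\mu$; $\mu\models P_1\oplus P_2$ iff $\mu=\mu_1+\mu_2$ for some POVDs with $\mu_1\models P_1$, $\mu_2\models P_2$; for $f$ from POVDs to POVDs, $\mu\models P[f]$ iff $f(\mu)\models P$. A sequence $(P_n)_{n\in\mathbb N\cup\{\infty\}}$ is u-closed if for every increasing sequence of POVDs $(\mu_n)_{n\in\mathbb N}$ with $\mu_n\models P_n$ for all $n\in\mathbb N$, $\lim_n\mu_n\models P_\infty$. Rules of $\mathcal S_a$: [Skip] $\{P\}\mathbf{skip}\{P\}$; [Abort] $\{P\}\mathbf{abort}\{\Box\mathbf{false}\}$; [Assgn] $\{P[[\![x:=a]\!]]\}x:=a\{P\}$; [Seq] from $\{P_0\}c_0\{P_1\}$ and $\{P_1\}c_1\{P_2\}$ infer $\{P_0\}c_0;c_1\{P_2\}$; [Split] from $\{P_0\}c\{P_0'\}$ and $\{P_1\}c\{P_1'\}$ infer $\{P_0\oplus P_1\}c\{P_0'\oplus P_1'\}$; [Cond] from $\{P_0\wedge\Box b\}c_0\{P_0'\}$ and $\{P_1\wedge\Box\neg b\}c_1\{P_1'\}$ infer $\{(P_0\wedge\Box b)\oplus(P_1\wedge\Box\neg b)\}\mathbf{if}\ b\ \mathbf{then}\ c_0\ \mathbf{else}\ c_1\{P_0'\oplus P_1'\}$; [Absurd] $\{\mathbf{false}\}c\{P\}$; [Conseq] from $P_0\Rightarrow P_1$, $\{P_1\}c\{P_2\}$, $P_2\Rightarrow P_3$ infer $\{P_0\}c\{P_3\}$;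 [All] from $\{\mathbf 1_\mu\wedge P\}c\{P'\}$ for all POVDs $\mu$ infer $\{P\}c\{P'\}$; [While] if $(P_n')_{n\in\mathbb N\cup\{\infty\}}$ is u-closed, $\{P_n\}\mathbf{if}\ b\ \mathbf{then}\ c\{P_{n+1}\}$ and $\{P_n\}\mathbf{if}\ b\ \mathbf{then}\ \mathbf{abort}\{P_n'\}$ for all $n\in\mathbb N$, infer $\{P_0\}\mathbf{while}\ b\ \mathbf{do}\ c\{P_\infty'\wedge\Box\neg b\}$; [QInit] $\{P[[\![q:=|0\rangle]\!]]\}q:=|0\rangle\{P\}$; [QUnit] $\{P[[\![U[\bar q]]\!]]\}U[\bar q]\{P\}$; [QMeas] $\{P[[\![x:=M[\bar q]]\!]]\}x:=M[\bar q]\{P\}$. *)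

(* Defs.v *)
From HB Require Import structures.
From mathcomp Require Import all_boot all_order all_algebra.
From mathcomp Require Import spectral.
From mathcomp Require Import all_classical all_reals all_analysis.
From mathcomp Require Import complex.

Set Implicit Arguments.
Unset Strict Implicit.
Unset Printing Implicit Defensive.

Import Order.TTheory GRing.Theory Num.Theory.
Import numFieldNormedType.Exports.

Local Open Scope classical_set_scope.
Local Open Scope sesquilinear_scope.
Local Open Scope complex_scope.
Local Open Scope ring_scope.

(* R[i] does not inherit the generic norm topology of a numClosedFieldType. *)
HB.instance Definition _ (R : realType) := PseudoPointedMetric.copy R[i] R[i]^o.
HB.instance Definition _ (R : realType) := NormedModule.copy R[i] R[i]^o.

Section Expressions.
Variable X : eqType.

Definition state := X -> int.

Definition update (s : state) (x : X) (n : int) : state :=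
  fun y => if y == x then n else s y.

Inductive aexp :=
| ANum of int
| AVar of X
| AAdd of aexp & aexp
| ASub of aexp & aexp
| AMul of aexp & aexp.

Inductive bexp :=
| BTrue
| BFalse
| BEq of aexp & aexp
| BLe of aexp & aexp
| BNot of bexp
| BAnd of bexp & bexp
| BOr of bexp & bexp.

Fixpoint aeval (a : aexp) (s : state) : int :=
  match a with
  | ANum n => n
  | AVar x => s x
  | AAdd a0 a1 => aeval a0 s + aeval a1 s
  | ASub a0 a1 => aeval a0 s - aeval a1 s
  | AMul a0 a1 => aeval a0 s * aeval a1 s
  end.

Fixpoint beval (b : bexp) (s : state) : bool :=
  match b with
  | BTrue => true
  | BFalse => false
  | BEq a0 a1 => aeval a0 s == aeval a1 s
  | BLe a0 a1 => aeval a0 s <= aeval a1 s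
  | BNot b0 => ~~ beval b0 s
  | BAnd b0 b1 => beval b0 s && beval b1 s
  | BOr b0 b1 => beval b0 s || beval b1 s
  end.

End Expressions.

Section Operators.
Variable R : realType.

(* The computational basis of the tensor product of copies of C^2 indexed by
   [W] consists of the vectors |f> for [f : {ffun W -> bool}]; the matrix index
   [i] stands for the basis vector |ket i>. *)
Definition qdim (W : finType) : nat := #|{: {ffun W -> bool}}|.

Definition ket (W : finType) (i : 'I_(qdim W)) : {ffun W -> bool} := enum_val i.

Definition op (W : finType) := 'M[R[i]]_(qdim W).

Definition psd (W : finType) (A : op W) : Prop :=
  forall v : 'rV[R[i]]_(qdim W), 0 <= (v *m A *m v^t*) 0 0.

Definition lowner (W : finType) (A B : op W) : Prop := psd (B - A).

(* [embed q A] is A acting on the qubits [q], tensored with the identity on the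
   remaining qubits. *)
Definition embed (W : finType) (k : nat) (q : k.-tuple W) (A : op 'I_k) : op W :=
  \matrix_(i, j)
    if [forall w, (w \notin q) ==> (ket i w == ket j w)]
    then A (enum_rank [ffun l => ket i (tnth q l)])
           (enum_rank [ffun l => ket j (tnth q l)])
    else 0.

(* |a><b| on a single qubit. *)
Definition ketbra (a b : bool) : op 'I_1 :=
  \matrix_(i, j) ((ket i ord0 == a) && (ket j ord0 == b))%:R.

(* The finite subsets of [D], directed by inclusion. *)
Definition fsets_filter (I : choiceType) (D : set I) : set_system (set I) :=
  filter_from (fsets D) (fun A => [set B | fsets D B /\ A `<=` B]).

(* Unordered sum: the limit of the finite partial sums. *)
Definition opsum (W : finType) (I : choiceType) (D : set I) (F : I -> op W) :
    op W :=
  lim ((fun A : set I => \sum_(i \in A) F i) @ fsets_filter D).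

Record measurement (k : nat) := Measurement {
  outcomes : set int;
  mop : int -> op 'I_k;
  mop_complete : (fun A : set int => \sum_(i \in A) (mop i)^t* *m mop i)
        @ fsets_filter outcomes --> (1%:M : op 'I_k) }.

End Operators.

Section QIMP.
Variables (R : realType) (V : finType) (X : eqType).

Inductive cmd :=
| Skip
| Abort
| Assign (x : X) (a : aexp X)
| Seq (c0 c1 : cmd)
| If (b : bexp X) (c0 c1 : cmd)
| While (b : bexp X) (c : cmd)
| QInit (q : V)
| QUnit (k : nat) (q : k.-tuple V) (_ : uniq q)
    (U : op R 'I_k) (_ : U \is unitarymx)
| QMeas (x : X) (k : nat) (q : k.-tuple V) (_ : uniq q) (M : measurement R k).

Local Notation dist := (state X -> op R V).

Definition supp (mu : dist) : set (state X) := [set s | mu s != 0].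

Definition dpoint (s : state X) (rho : op R V) : dist :=
  fun s' => if s' == s then rho else 0.

Definition dzero : dist := fun=> 0.

Definition dlim (mu : nat -> dist) : dist := fun s => lim (mu n s @[n --> \oo]).

Definition is_povd (mu : dist) : Prop :=
  (forall s, psd (mu s)) /\
  (\esum_(s in [set: state X]) (complex.Re (\tr (mu s)))%:E <= 1)%E.

Record povd := Povd { povd_val :> dist; povdP : is_povd povd_val }.

Definition extend (K : state X -> op R V -> dist) (mu : dist) : dist :=
  fun s' => opsum (supp mu) (fun s => K s (mu s) s').

(* [sem_at c s rho] is the semantics of [c] on the point distribution
   (s, rho). In the loop case, [body] and [exit] are the semantics of
   "if b then c" and "if b then abort", and [pow n] that of the n-fold
   iteration of the former; see [sem_atW]. *)
Fixpoint sem_at (c : cmd) (s : state X) (rho : op R V) : dist :=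
  match c with
  | Skip => dpoint s rho
  | Abort => dzero
  | Assign x a => dpoint (update s x (aeval a s)) rho
  | Seq c0 c1 => extend (sem_at c1) (sem_at c0 s rho)
  | If b c0 c1 => if beval b s then sem_at c0 s rho else sem_at c1 s rho
  | While b c =>
      let body s rho := if beval b s then sem_at c s rho else dpoint s rho in
      let exit s rho := if beval b s then dzero else dpoint s rho in
      let pow n := iter n (extend body) (dpoint s rho) in
      dlim (fun n => extend exit (pow n))
  | QInit q =>
      let K a b := embed [tuple q] (ketbra R a b) in
      dpoint s (K false false *m rho *m K false false
               + K false true *m rho *m K true false)
  | QUnit _ q _ U _ => dpoint s (embed q U *m rho *m (embed q U)^t*)
  | QMeas x _ q _ M => fun s' =>
      opsum [set i | outcomes M i /\ update s x i = s']
            (fun i => embed q (mop M i) *m rho *m (embed q (mop M i))^t*)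
  end.

Definition sem (c : cmd) (mu : dist) : dist := extend (sem_at c) mu.

Definition if_then (b : bexp X) (c : cmd) : cmd := If b c Skip.

Fixpoint cpow (c : cmd) (n : nat) : cmd :=
  if n is m.+1 then Seq (cpow c m) c else Skip.

Lemma sem_atW (b : bexp X) (c : cmd) (s : state X) (rho : op R V) :
  sem_at (While b c) s rho =
  dlim (fun n => sem_at (Seq (cpow (if_then b c) n) (if_then b Abort)) s rho).
Proof.
rewrite /=; congr dlim; apply/funext => n; congr extend.
by elim: n => //= n ->.
Qed.

Definition assertion := set povd.

(* The semantic functions are defined on all maps from states to operators;
   that their value is a POVD is part of satisfaction. *)
Definition sat (mu : dist) (P : assertion) : Prop :=
  exists h : is_povd mu, P (Povd h).

Definition box (psi : set (state X)) : assertion :=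
  [set mu : povd | supp mu `<=` psi].

Definition oplus (P1 P2 : assertion) : assertion :=
  [set mu : povd | exists mu1 mu2 : povd,
     [/\ P1 mu1, P2 mu2 & forall s, mu s = mu1 s + mu2 s]].

Definition asubst (P : assertion) (f : dist -> dist) : assertion :=
  [set mu : povd | sat (f mu) P].

Definition u_closed (P : nat -> assertion) (Poo : assertion) : Prop :=
  forall mu : nat -> povd,
    (forall n s, lowner (mu n s) (mu n.+1 s)) ->
    (forall n, P n (mu n)) -> sat (dlim (fun n => mu n)) Poo.

Inductive derivable : assertion -> cmd -> assertion -> Prop :=
| RSkip P : derivable P Skip P
| RAbort P : derivable P Abort (box (beval (BFalse X)))
| RAssgn P x a : derivable (asubst P (sem (Assign x a))) (Assign x a) P
| RSeq P0 P1 P2 c0 c1 :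
    derivable P0 c0 P1 -> derivable P1 c1 P2 -> derivable P0 (Seq c0 c1) P2
| RSplit P0 P0' P1 P1' c :
    derivable P0 c P0' -> derivable P1 c P1' ->
    derivable (oplus P0 P1) c (oplus P0' P1')
| RCond P0 P0' P1 P1' b c0 c1 :
    derivable (P0 `&` box (beval b)) c0 P0' ->
    derivable (P1 `&` box (beval (BNot b))) c1 P1' ->
    derivable (oplus (P0 `&` box (beval b)) (P1 `&` box (beval (BNot b))))
      (If b c0 c1) (oplus P0' P1')
| RAbsurd c P : derivable set0 c P
| RConseq P0 P1 P2 P3 c :
    P0 `<=` P1 -> derivable P1 c P2 -> P2 `<=` P3 -> derivable P0 c P3
| RAll P P' c :
    (forall mu : povd, derivable ([set mu] `&` P) c P') -> derivable P c P'
| RWhile (P P' : nat -> assertion) (Poo' : assertion) b c :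
    u_closed P' Poo' ->
    (forall n, derivable (P n) (if_then b c) (P n.+1)) ->
    (forall n, derivable (P n) (if_then b Abort) (P' n)) ->
    derivable (P 0%N) (While b c) (Poo' `&` box (beval (BNot b)))
| RQInit P q : derivable (asubst P (sem (QInit q))) (QInit q) P
| RQUnit P k (q : k.-tuple V) (uq : uniq q) U (hU : U \is unitarymx) :
    derivable (asubst P (sem (QUnit uq hU))) (QUnit uq hU) P
| RQMeas P x k (q : k.-tuple V) (uq : uniq q) M :
    derivable (asubst P (sem (QMeas x uq M))) (QMeas x uq M) P.

Definition valid (P : assertion) (c : cmd) (P' : assertion) : Prop :=
  forall mu : povd, P mu -> sat (sem c mu) P'.

End QIMP.

(* Main.v *)
(** The quadratic forms [v A v^*] determine a positive operator [A] by
    polarization, and turn unordered sums and increasing limits of positive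
    operators into sums and suprema of nonnegative reals.  The semantics of every
    command at a classical state is positive, additive and trace-nonincreasing;
    these three properties already imply countable additivity, since a tail of
    small trace has an image of small trace.  Exchanging sums of nonnegative
    reals then shows that [[c0; c1]] is [[c1]] after [[c0]], that [[c]] is
    additive, and that a loop denotes the increasing limit of its truncations;
    soundness follows by induction on derivations. *)
From HB Require Import structures.
From mathcomp Require Import all_boot all_order all_algebra.
From mathcomp Require Import spectral.
From mathcomp Require Import all_classical all_reals all_analysis.
From mathcomp Require Import complex ring lra.
Require Import Defs.

Set Implicit Arguments.
Unset Strict Implicit.
Unset Printing Implicit Defensive.

Import Order.TTheory GRing.Theory Num.Theory.
Import numFieldNormedType.Exports.

Local Open Scope classical_set_scope.
Local Open Scope sesquilinear_scope.
Local Open Scope complex_scope.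
Local Open Scope ring_scope.

(** * Convergence in the complex numbers through real parts *)

Section ComplexTopology.
Variable R : realType.

Lemma ReD (z w : R[i]) : complex.Re (z + w) = complex.Re z + complex.Re w.
Proof. by case: z w => [? ?] []. Qed.

Lemma normc_geRe (z : R[i]) : `|complex.Re z|%:C <= `|z|.
Proof.
by rewrite normc_def lecR -sqrtr_sqr ler_wsqrtr// lerDl sqr_ge0.
Qed.

Lemma cvg_Re (T : Type) (F : set_system T) (FF : Filter F) (f : T -> R[i]) z :
  f @ F --> z -> (fun t => complex.Re (f t)) @ F --> complex.Re z.
Proof.
move=> fz; apply/cvgrPdist_lt => e e0.
have e0' : 0 < e%:C by rewrite ltcR.
move/cvgrPdist_lt : fz => /(_ _ e0'); apply: filterS => t.
move=> /(le_lt_trans (normc_geRe _)); rewrite ltcR.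
by case: (z) (f t) => [a b] [c d].
Qed.

Lemma cvg_real_complex (T : Type) (F : set_system T) (FF : Filter F)
    (f : T -> R) (x : R) :
  f @ F --> x -> (fun t => (f t)%:C : R[i]) @ F --> (x%:C : R[i]).
Proof.
(* A positive complex radius has zero imaginary part, so a real radius suffices. *)
move=> fx; apply/cvgrPdist_lt => e; rewrite ltcE/= => /andP[/eqP e1 e0].
move/cvgrPdist_lt : fx => /(_ _ e0); apply: filterS => t h.
rewrite -rmorphB normc_def/= expr0n addr0 sqrtr_sqr ltcE/= e1 eqxx/=.
exact: h.
Qed.

End ComplexTopology.

(** * Entrywise convergence of matrices and the Hausdorff property *)

Section MatrixTopology.
Variables (T : ptopologicalType) (m n : nat).

(** Basic neighbourhoods of a matrix are products of neighbourhoods of its entries; there are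
    finitely many entries, so a filter can meet all these conditions at once. *)
Lemma cvg_mxP (U : Type) (F : set_system U) (FF : Filter F)
    (f : U -> 'M[T]_(m, n)) (A : 'M[T]_(m, n)) :
  f @ F --> A <-> forall i j, (fun u => f u i j) @ F --> A i j.
Proof.
split=> [fA i j P PA|fA P [Q QA QP]].
  apply: (fA [set M | P (M i j)]); 
    exists (fun i' j' => if (i' == i) && (j' == j) then P else setT).
    by move=> i' j'; case: ifP => [/andP[/eqP-> /eqP->]//|_]; exact: filterT.
  by move=> M /(_ i j); rewrite !eqxx.
have : \forall u \near F, forall i j, Q i j (f u i j).
  apply: filter_forall => i; apply: filter_forall => j.
  by apply: fA; exact: QA.
by apply: filterS => u Qu; apply: QP.
Qed.

Lemma mx_hausdorff : hausdorff_space T -> hausdorff_space 'M[T]_(m, n).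
Proof.
move=> hT p q pq; apply/matrixP => i j; apply: hT => A B Ap Bq.
have c (M : 'M[T]_(m, n)) : (fun u : 'M[T]_(m, n) => u i j) @ M --> M i j.
  by have /cvg_mxP := @cvg_id _ (nbhs M); apply.
have [M []] := pq _ _ (c _ _ Ap) (c _ _ Bq).
by exists (M i j).
Qed.

End MatrixTopology.

(** * Quadratic forms of operators and polarization *)

Section Psd.
Variables (R : realType) (W : finType).
Implicit Types (A B : op R W) (v : 'rV[R[i]]_(qdim W)).

Definition qformc A v : R[i] := (v *m A *m v^t*) 0 0.

(** A real value gives access to suprema and extended-real sums; on positive operators nothing is
    lost, by [psd_qformc]. *)
Definition qform A v : R := complex.Re (qformc A v).

Lemma qformcE A v :
  qformc A v = \sum_l (\sum_k v 0 k * A k l) * (v 0 l)^*.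
Proof.
rewrite /qformc mxE; apply: eq_bigr => l _; rewrite mxE.
by congr (_ * _); rewrite !mxE.
Qed.

Lemma psd_qformc A v : psd A -> qformc A v = (qform A v)%:C.
Proof.
move=> /(_ v); rewrite lecE/= => /andP[/eqP h _].
by apply/eqP; rewrite eq_complex/= h !eqxx.
Qed.

Lemma qform_ge0 A v : psd A -> 0 <= qform A v.
Proof. by move=> /(_ v); rewrite lecE/= => /andP[]. Qed.

Lemma qformcD A B v : qformc (A + B) v = qformc A v + qformc B v.
Proof. by rewrite /qformc mulmxDr mulmxDl mxE. Qed.

Lemma qformD A B v : qform (A + B) v = qform A v + qform B v.
Proof. by rewrite /qform qformcD ReD. Qed.

Lemma qform0 v : qform 0 v = 0.
Proof. by rewrite /qform /qformc mulmx0 mul0mx mxE. Qed.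

Lemma qformcN A v : qformc (- A) v = - qformc A v.
Proof. by rewrite /qformc mulmxN mulNmx mxE. Qed.

Lemma qformN A v : qform (- A) v = - qform A v.
Proof. by rewrite /qform qformcN; case: (qformc A v). Qed.

Lemma qformB A B v : qform (A - B) v = qform A v - qform B v.
Proof. by rewrite qformD qformN. Qed.

Lemma psd0 : psd (0 : op R W).
Proof. by move=> v; rewrite mulmx0 mul0mx mxE. Qed.

Lemma psdD A B : psd A -> psd B -> psd (A + B).
Proof.
by move=> pA pB v; rewrite [X in 0 <= X]qformcD addr_ge0//; [exact: pA|exact: pB].
Qed.

Lemma lownerP A B : psd A -> psd B ->
  lowner A B <-> forall v, qform A v <= qform B v.
Proof.
move=> pA pB; split=> [AB v|AB v].
  by rewrite -subr_ge0 -qformB; exact: qform_ge0.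
rewrite [X in 0 <= X](_ : _ = qformc (B - A) v)//.
by rewrite qformcD qformcN !psd_qformc// -rmorphB ler0c subr_ge0.
Qed.

(** The form of [E *m A *m E^t*] at [v] is the form of [A] at [v *m E]. *)
Lemma psd_congr A (E : op R W) : psd A -> psd (E *m A *m E^t*).
Proof.
by move=> pA v; have := pA (v *m E); rewrite trmx_mul map_mxM !mulmxA.
Qed.

Definition pvec (k l : 'I_(qdim W)) (n : nat) : 'rV[R[i]]_(qdim W) :=
  delta_mx 0 k + ('i ^+ n) *: delta_mx 0 l.

(** The form at [pvec k l n] is a combination of [A k k], [A k l], [A l k] and [A l l]. After
    weighting by ['i ^+ n] and summing over the four values of [n], powers of ['i] cancel every
    entry except [A k l], which is counted four times. *)
Lemma polarization A k l :
  A k l = 4^-1 * \sum_(n < 4) ('i ^+ n * qformc A (pvec k l n)).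
Proof.
have conj_i : ('i : R[i])^* = - 'i.
  by apply/eqP; rewrite eq_complex/= oppr0 !eqxx.
have conj_iX n : (('i : R[i]) ^+ n)^* = (- 'i) ^+ n.
  by rewrite -conj_i; exact: (rmorphXn (@conjc R)).
have h n : qformc A (pvec k l n) = A k k + (- 'i) ^+ n * A k l
    + 'i ^+ n * A l k + 'i ^+ n * (- 'i) ^+ n * A l l.
  rewrite -conj_iX /qformc /pvec linearD/= map_mxD linearZ/= map_mxZ !trmx_delta.
  rewrite !map_delta_mx !mulmxDl !mulmxDr -!scalemxAl -!scalemxAr.
  rewrite -!rowE -!colE !mxE; ring.
have i2 : ('i : R[i]) ^+ 2 = -1 := sqr_i R.
under eq_bigr do rewrite h.
rewrite !big_ord_recr big_ord0/=.
by field: i2.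
Qed.

End Psd.

(** * Trace bounds and convergence of positive operators *)

Section PsdMass.
Variables (R : realType) (W : finType).
Implicit Types (A B : op R W) (v : 'rV[R[i]]_(qdim W)).

(** On positive operators this is the trace norm. *)
Definition mass A : R := complex.Re (\tr A).

Lemma qform_inj A B : psd A -> psd B -> qform A =1 qform B -> A = B.
Proof.
move=> pA pB AB; apply/matrixP => k l; rewrite !polarization; congr (_ * _).
by apply: eq_bigr => n _; rewrite !psd_qformc// AB.
Qed.

Lemma qform_delta A k : qform A (delta_mx 0 k) = complex.Re (A k k).
Proof.
rewrite /qform /qformc trmx_delta map_delta_mx.
by rewrite -rowE -colE !mxE.
Qed.

Lemma massE A : mass A = \sum_k qform A (delta_mx 0 k).
Proof.
rewrite /mass /mxtrace (big_morph (@complex.Re R) (id1 := 0) (op1 := +%R))//.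
  by apply: eq_bigr => k _; rewrite qform_delta.
exact: ReD.
Qed.

Lemma mass_ge0 A : psd A -> 0 <= mass A.
Proof. by move=> pA; rewrite massE sumr_ge0// => k _; exact: qform_ge0. Qed.

Lemma mass0 : mass 0 = 0.
Proof. by rewrite /mass mxtrace0. Qed.

Lemma massD A B : mass (A + B) = mass A + mass B.
Proof. by rewrite /mass mxtraceD; case: (\tr A) (\tr B) => [? ?] []. Qed.

Lemma massB A B : mass (A - B) = mass A - mass B.
Proof. by apply/eqP; rewrite eq_sym subr_eq -massD subrK. Qed.

Lemma qform_parallelogram A u v :
  qform A (u + v) + qform A (u - v) = 2 * qform A u + 2 * qform A v.
Proof.
have : qformc A (u + v) + qformc A (u - v)
    = (qformc A u + qformc A u) + (qformc A v + qformc A v).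
  rewrite /qformc !linearD/= !linearN/= !map_mxD map_mxN !mulmxDl !mulmxDr.
  by rewrite !mulNmx !mulmxN !mxE; ring.
by move=> /(congr1 (@complex.Re R)); rewrite !ReD /qform => ->; ring.
Qed.

Lemma qformcZ A (z : R[i]) v : qformc A (z *: v) = (z * z^*) * qformc A v.
Proof.
rewrite /qformc linearZ/= map_mxZ -!scalemxAl -scalemxAr !mxE.
by rewrite mulrA.
Qed.

(** The constant depends on [v] only, so a bound on traces controls all forms uniformly. At a basis
    vector the form is a diagonal entry, hence at most the trace; a scalar [z] contributes
    [z * z^*], and sums of vectors are handled by the parallelogram law. *)
Lemma qform_le_mass v : exists2 c : R, 0 <= c &
  forall A, psd A -> qform A v <= c * mass A.
Proof.
rewrite (row_sum_delta v); pose P (u : 'rV[R[i]]_(qdim W)) := exists2 c : R,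
  0 <= c & forall A, psd A -> qform A u <= c * mass A.
apply: (big_ind P).
- exists 0 => // A pA; rewrite mul0r.
  by rewrite /qform /qformc !mul0mx mxE.
(* The constant comes from the parallelogram law after dropping the nonnegative form at [u - w]. *)
- move=> u w [c c0 uc] [d d0 wd]; exists (2 * c + 2 * d); first lra.
  move=> A pA; have := qform_parallelogram A u w.
  have := qform_ge0 (u - w) pA; have := uc _ pA; have := wd _ pA; nra.
- move=> k _; set z := v 0 k.
  exists (complex.Re (z * z^*)).
    by have := mulcJ_ge0 z; rewrite lecE => /andP[].
  move=> A pA; have := qformcZ A z (delta_mx 0 k).
  rewrite !psd_qformc// => /(congr1 (@complex.Re R))/= ->.
  have : 0 <= complex.Re (z * z^*).
    by have := mulcJ_ge0 z; rewrite lecE => /andP[].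
  case: (z * z^*) => a b/= a0; rewrite mulr0 subr0 ler_wpM2l//.
  rewrite massE (bigD1 k)//= lerDl sumr_ge0// => j _; exact: qform_ge0.
Qed.

(** Entries are fixed linear combinations of forms, so pointwise convergence of the forms forces
    convergence of the operators; continuity then identifies the forms of the limit, which are
    limits of nonnegative reals. *)
Lemma psd_cvg (T : Type) (F : set_system T) (FF : ProperFilter F)
    (f : T -> op R W) (L : 'rV[R[i]]_(qdim W) -> R) :
  (\forall t \near F, psd (f t)) ->
  (forall v, (fun t => qform (f t) v) @ F --> L v) ->
  [/\ f @ F --> lim (f @ F), psd (lim (f @ F)) & qform (lim (f @ F)) =1 L].
Proof.
move=> fp fL.
have fLc v : (fun t => qformc (f t) v) @ F --> ((L v)%:C : R[i]).
  apply: cvg_trans (cvg_real_complex FF (fL v)).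
  apply: near_eq_cvg; apply: filterS fp => t pt.
  by rewrite /= psd_qformc.
(* The candidate limit is the polarization formula applied to the limiting forms [L]. *)
pose A : op R W := \matrix_(k, l)
  (4^-1 * \sum_(n < 4) ('i ^+ n * ((L (pvec R k l n))%:C : R[i]))).
have fA : f @ F --> A.
  apply/cvg_mxP => k l; rewrite /A mxE.
  under eq_cvg do rewrite polarization.
  apply: cvgM; first exact: cvg_cst.
  apply: (cvg_big (op := +%R)) => [|n _]; first exact: add_continuous.
  by apply: cvgM; [exact: cvg_cst|exact: fLc].
have -> : lim (f @ F) = A.
  apply: cvg_lim => //; apply: mx_hausdorff; exact: norm_hausdorff.
have AL v : qformc A v = (L v)%:C.
  apply: (@cvg_unique _ (@norm_hausdorff _ _) ((fun t => qformc (f t) v) @ F)).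
  - rewrite /= qformcE.
    under eq_cvg do rewrite qformcE.
    apply: (cvg_big (op := +%R)) => [|l _]; first exact: add_continuous.
    apply: cvgM; last exact: cvg_cst.
    apply: (cvg_big (op := +%R)) => [|k _]; first exact: add_continuous.
    by apply: cvgM; [exact: cvg_cst|move/cvg_mxP : fA; apply].
  - exact: fLc.
have L0 v : 0 <= L v.
  apply: (cvgr_to_ge (fL v)); apply: filterS fp => t; exact: qform_ge0.
split=> // [v|v]; last by rewrite /qform AL.
by have := AL v; rewrite /qformc => ->; rewrite ler0c.
Qed.

End PsdMass.

(** * Sums of extended reals over arbitrary sets *)

Section EsumComplements.
Variable R : realType.
Local Open Scope ereal_scope.

(** Tonelli for sums: both sides are one sum over a product set, up to swapping coordinates. *)
Lemma esum_exchange (I J : choiceType) (D : set I) (E : set J)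
    (a : I -> J -> \bar R) : (forall i j, D i -> E j -> 0 <= a i j) ->
  \esum_(i in D) \esum_(j in E) a i j = \esum_(j in E) \esum_(i in D) a i j.
Proof.
move=> a0; rewrite (@esum_esum _ _ _ _ (fun=> E))//.
rewrite (@esum_esum _ _ _ E (fun=> D)); last by move=> j i Ej Di; exact: a0.
rewrite (reindex_esum (E `*` D) _ (fun x => (x.2, x.1)))//; split=> //=.
- by move=> [i j] [/=].
- by move=> [i1 i2] [j1 j2] /= _ _ [] -> ->.
- by move=> [i1 i2] [Pi1 Qi2] /=; exists (i2, i1).
Qed.

Lemma esum_single (I : choiceType) (D : set I) (a : I -> \bar R) i0 :
  D i0 -> 0 <= a i0 -> (forall i, i != i0 -> a i = 0) ->
  \esum_(i in D) a i = a i0.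
Proof.
move=> Di0 a0 a1; rewrite -[RHS]esum_set1//.
rewrite (esum_mkcond D) (esum_mkcond [set i0]); apply: eq_esum => i _.
have [->|ni] := eqVneq i i0; first by rewrite !mem_set.
by rewrite a1//; do 2!case: ifP.
Qed.

Lemma le_esum_term (I : choiceType) (D : set I) (a : I -> \bar R) i0 :
  D i0 -> a i0 <= \esum_(i in D) a i.
Proof.
move=> Di0; apply: esum_ge; exists [set i0]; last by rewrite fsbig_set1.
by split; [exact: finite_set1|move=> _ ->].
Qed.

Lemma le_esum_subset (I : choiceType) (D E : set I) (a : I -> \bar R) :
  D `<=` E -> \esum_(i in D) a i <= \esum_(i in E) a i.
Proof.
move=> DE; apply: ge_ereal_sup => _ [A [fA AD] <-].
by apply: esum_ge; exists A => //; split=> // i /AD/DE.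
Qed.


End EsumComplements.

(** * Convergence along finite subsets *)

Section UnorderedSums.
Variable I : choiceType.
Implicit Types D : set I.

Lemma fsets_filter_proper D : ProperFilter (fsets_filter D).
Proof.
apply: filter_from_proper; last by move=> A DA; exists A; split.
apply: filter_from_filter; first by exists set0; exact: fsets_set0.
move=> A B [fA AD] [fB BD]; exists (A `|` B).
  by split; [rewrite finite_setU|rewrite subUset].
by move=> C [fC]; rewrite subUset => -[AC BC]; split.
Qed.

Lemma near_fsets D : \forall A \near fsets_filter D, fsets D A.
Proof. by exists set0; [exact: fsets_set0|move=> A []]. Qed.

(** The total is a supremum of finite partial sums. Some finite set comes within [e] of it, and by
    nonnegativity every larger one stays between that partial sum and the total. *)
Lemma cvg_fsum (R : realType) D (a : I -> R) :
  (forall i, D i -> 0 <= a i) -> (\esum_(i in D) (a i)%:E < +oo)%E ->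
  (fun A => \sum_(i \in A) a i) @ fsets_filter D -->
    fine (\esum_(i in D) (a i)%:E)%E.
Proof.
move=> a0 aoo.
have FF := fsets_filter_proper D.
have sfin : (\esum_(i in D) (a i)%:E)%E \is a fin_num.
  rewrite ge0_fin_numE//; apply: esum_ge0 => i /a0; by rewrite lee_fin.
apply/cvgrPdist_lt => e e0.
have : ((fine (\esum_(i in D) (a i)%:E) - e)%:E < \esum_(i in D) (a i)%:E)%E.
  by rewrite -[ltRHS]fineK// lte_fin ltrBlDr ltrDl.
move=> /ereal_sup_gt[_ [A [fA AD] <-]].
rewrite fsumEFin// lte_fin => hA; exists A => // B [[fB BD] AB].
have AleB : \sum_(i \in A) a i <= \sum_(i \in B) a i.
  rewrite -lee_fin -!fsumEFin//; apply: lee_fsum_nneg_subset => //.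
    exact/subsetP.
  by move=> i; rewrite inE/= => /andP[_]; rewrite inE => /BD/a0; rewrite lee_fin.
have Ble : \sum_(i \in B) a i <= fine (\esum_(i in D) (a i)%:E)%E.
  by rewrite -lee_fin fineK// -fsumEFin//; apply: esum_ge; exists B.
rewrite /= ger0_norm ?subr_ge0//; move: hA AleB; lra.
Qed.

End UnorderedSums.

(** * Unordered sums of positive operators *)

Section OperatorSums.
Variables (R : realType) (W : finType) (I : choiceType).
Implicit Types (D : set I) (F : I -> op R W).

Lemma qform_fsum D F v : finite_set D ->
  qform (\sum_(i \in D) F i) v = \sum_(i \in D) qform (F i) v.
Proof.
move=> fD; rewrite !fsbig_finite//=.
by rewrite (big_morph (fun A => qform A v) (id1 := 0) (op1 := +%R))//;
  [move=> A B; exact: qformD|exact: qform0].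
Qed.

Lemma mass_fsum D F : finite_set D ->
  mass (\sum_(i \in D) F i) = \sum_(i \in D) mass (F i).
Proof.
move=> fD; rewrite !fsbig_finite//=.
by rewrite (big_morph (@mass R W) (id1 := 0) (op1 := +%R))//;
  [move=> A B; exact: massD|exact: mass0].
Qed.

Lemma psd_fsum D F : finite_set D -> (forall i, D i -> psd (F i)) ->
  psd (\sum_(i \in D) F i).
Proof.
move=> fD pF; rewrite fsbig_finite//= big_seq.
apply: big_ind => [|A B|i]; [exact: psd0|exact: psdD|].
by rewrite in_fset_set// inE => /pF.
Qed.

(** Finite total mass bounds the sums of all forms through [qform_le_mass]; it is the condition that
    makes [opsum] a genuine limit. *)
Definition summable_psd D F :=
  (forall i, D i -> psd (F i)) /\ (\esum_(i in D) (mass (F i))%:E < +oo)%E.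

Lemma esum_qform_fin D F v : summable_psd D F ->
  (\esum_(i in D) (qform (F i) v)%:E < +oo)%E.
Proof.
move=> [pF mF]; have [c c0 hc] := qform_le_mass v.
apply: (@le_lt_trans _ _ (\esum_(i in D) (c%:E * (mass (F i))%:E))%E).
  by apply: le_esum => i /pF pi; rewrite -EFinM lee_fin hc.
set S := (\esum_(i in D) (mass (F i))%:E)%E in mF.
have S0 : (0 <= S)%E.
  by apply: esum_ge0 => i /pF/mass_ge0; rewrite lee_fin.
apply: (@le_lt_trans _ _ (c%:E * S)%E); last first.
  by rewrite -(@fineK _ S) ?ge0_fin_numE// -EFinM ltry.
apply: ge_ereal_sup => _ [A [fA AD] <-].
rewrite fsbig_finite//= big_seq -ge0_sume_distrr; last first.
  by move=> i; rewrite in_fset_set// inE => /AD/pF/mass_ge0; rewrite lee_fin.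
rewrite lee_wpmul2l//.
by apply: esum_ge; exists A => //; rewrite fsbig_finite//= big_seq.
Qed.

(** The forms of the partial sums converge by [cvg_fsum], and [psd_cvg] lifts this to operators.
    Hence the [lim] inside [opsum] is not a default value. *)
Lemma opsum_psd_cvg D F : summable_psd D F ->
  [/\ (fun A => \sum_(i \in A) F i) @ fsets_filter D --> opsum D F,
      psd (opsum D F) &
      forall v, qform (opsum D F) v = fine (\esum_(i in D) (qform (F i) v)%:E)%E].
Proof.
move=> sF; have [pF mF] := sF.
have FF := fsets_filter_proper D.
apply: psd_cvg.
  by apply: filterS (near_fsets D) => A [fA AD]; apply: psd_fsum => // i /AD/pF.
move=> v; apply: cvg_trans (cvg_fsum (R := R) _ (esum_qform_fin v sF)).
  apply: near_eq_cvg; apply: filterS (near_fsets D) => A [fA _].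
  by rewrite qform_fsum.
by move=> i /pF; exact: qform_ge0.
Qed.

Lemma psd_opsum D F : summable_psd D F -> psd (opsum D F).
Proof. by move=> /opsum_psd_cvg[]. Qed.

Lemma qform_opsum D F v : summable_psd D F ->
  ((qform (opsum D F) v)%:E = \esum_(i in D) (qform (F i) v)%:E)%E.
Proof.
move=> sF; have [pF _] := sF; have [_ _ ->] := opsum_psd_cvg sF.
rewrite fineK// ge0_fin_numE ?esum_qform_fin//.
by apply: esum_ge0 => i /pF/qform_ge0; rewrite lee_fin.
Qed.

Lemma mass_opsum D F : summable_psd D F ->
  ((mass (opsum D F))%:E = \esum_(i in D) (mass (F i))%:E)%E.
Proof.
move=> sF; have [pF _] := sF; rewrite massE -sumEFin.
under eq_bigr do rewrite qform_opsum//.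
rewrite -esum_sum; last by move=> i j /pF/qform_ge0; rewrite lee_fin.
by apply: eq_esum => i _; rewrite massE -sumEFin.
Qed.

Lemma summable_psdD D F G : summable_psd D F -> summable_psd D G ->
  summable_psd D (fun i => F i + G i).
Proof.
move=> [pF mF] [pG mG]; split=> [i Di|].
  by apply: psdD; [exact: pF|exact: pG].
under eq_esum do rewrite massD EFinD.
by rewrite esumD ?lte_add_pinfty// => i Di; rewrite lee_fin mass_ge0//;
  [exact: pF|exact: pG].
Qed.

Lemma opsumD D F G : summable_psd D F -> summable_psd D G ->
  opsum D (fun i => F i + G i) = opsum D F + opsum D G.
Proof.
move=> sF sG; have [pF _] := sF; have [pG _] := sG.
have sFG := summable_psdD sF sG.
apply: qform_inj; [exact: psd_opsum|by apply: psdD; exact: psd_opsum|move=> v].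
apply: EFin_inj; rewrite qformD EFinD.
rewrite (qform_opsum v sF) (qform_opsum v sG) (qform_opsum v sFG) -esumD.
- by apply: eq_esum => i _; rewrite qformD.
- by move=> i /pF/qform_ge0; rewrite lee_fin.
- by move=> i /pG/qform_ge0; rewrite lee_fin.
Qed.

End OperatorSums.

(** * Positive, additive, trace-nonincreasing maps and their extension to distributions *)

Section Subchannels.
Variables (R : realType) (V : finType) (X : eqType).
Local Notation dist := (state X -> op R V).
Implicit Types (k : op R V -> dist) (K : state X -> op R V -> dist) (mu : dist).

(** The mass bound concerns all final states together, which keeps images of summable distributions
    summable. *)
Record subchannel k : Prop := Subchannel {
  sc_psd : forall rho s, psd rho -> psd (k rho s);
  sc_add : forall rho1 rho2 s, psd rho1 -> psd rho2 ->
    k (rho1 + rho2) s = k rho1 s + k rho2 s;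
  sc_mass : forall rho, psd rho ->
    (\esum_(s in [set: state X]) (mass (k rho s))%:E <= (mass rho)%:E)%E }.

(** States outside the support thus contribute nothing, so sums over [supp mu] may be taken over all
    states. *)
Lemma sc0 k s : subchannel k -> k 0 s = 0.
Proof.
move=> hk; have := sc_add hk s (@psd0 R V) (@psd0 R V).
by rewrite addr0 => /eqP; rewrite -subr_eq subrr eq_sym => /eqP.
Qed.

Lemma sc_mass_le k rho s : subchannel k -> psd rho ->
  mass (k rho s) <= mass rho.
Proof.
move=> hk prho; rewrite -lee_fin; apply: le_trans (sc_mass hk prho).
exact: (le_esum_term (fun s => (mass (k rho s))%:E)).
Qed.

Lemma sc_summable k rho : subchannel k -> psd rho -> summable_psd setT (k rho).
Proof.
move=> hk prho; split=> [s _|]; first exact: sc_psd.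
by apply: le_lt_trans (sc_mass hk prho) _; rewrite ltry.
Qed.

Lemma sc_fsum k s (I : choiceType) (D : set I) (F : I -> op R V) :
  subchannel k -> finite_set D -> (forall i, D i -> psd (F i)) ->
  k (\sum_(i \in D) F i) s = \sum_(i \in D) k (F i) s.
Proof.
move=> hk fD pF; rewrite !fsbig_finite//=.
have : forall i, i \in finmap.enum_fset (fset_set D) -> psd (F i).
  by move=> i; rewrite in_fset_set// inE => /pF.
elim: (finmap.enum_fset _) => [|i r IHr] pr; first by rewrite !big_nil sc0.
have {}IHr := IHr (fun j jr => pr j (@mem_behead _ (i :: r) _ jr)).
rewrite !big_cons sc_add ?IHr//; first by apply: pr; rewrite mem_head.
rewrite big_seq; apply: big_ind => [|A B|j jr]; [exact: psd0|exact: psdD|].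
by apply: pr; rewrite inE jr orbT.
Qed.

Lemma lowner_fsum_opsum (I : choiceType) (D A : set I) (F : I -> op R V) :
  summable_psd D F -> fsets D A -> psd (opsum D F - \sum_(i \in A) F i).
Proof.
move=> sF [fA AD]; have [pF _] := sF.
have pA : psd (\sum_(i \in A) F i) by apply: psd_fsum => // i /AD/pF.
apply: (proj2 (lownerP pA (psd_opsum sF))) => v.
rewrite -lee_fin qform_opsum// qform_fsum// -fsumEFin//.
by apply: esum_ge; exists A.
Qed.

Lemma sc_summable_opsum k s (I : choiceType) (D : set I) (F : I -> op R V) :
  subchannel k -> summable_psd D F -> summable_psd D (fun i => k (F i) s).
Proof.
move=> hk [pF mF]; split=> [i Di|]; first exact/sc_psd/pF.
apply: le_lt_trans mF; apply: le_esum => i Di.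
by rewrite lee_fin sc_mass_le//; exact: pF.
Qed.

(** Additivity splits the image into a finite part and the image of a tail. The tail image is
    positive, which gives one inequality; its mass is at most that of the tail, which can be made
    small, and this gives the other. *)
Lemma sc_opsum k s (I : choiceType) (D : set I) (F : I -> op R V) :
  subchannel k -> summable_psd D F ->
  k (opsum D F) s = opsum D (fun i => k (F i) s).
Proof.
move=> hk sF; have [pF mF] := sF; have sK := sc_summable_opsum s hk sF.
have pS := psd_opsum sF.
have split_sum A v : fsets D A -> qform (k (opsum D F) s) v =
    \sum_(i \in A) qform (k (F i) s) v +
    qform (k (opsum D F - \sum_(i \in A) F i) s) v.
  move=> DA; have [fA AD] := DA.
  have pA : psd (\sum_(i \in A) F i) by apply: psd_fsum => // i /AD/pF.
  rewrite -[in LHS](subrK (\sum_(i \in A) F i) (opsum D F)) [in LHS]addrC.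
  rewrite [in LHS]sc_add//; last exact: lowner_fsum_opsum.
  by rewrite qformD sc_fsum// ?qform_fsum// => i /AD/pF.
apply: qform_inj; [exact: sc_psd|exact: psd_opsum|move=> v].
apply: EFin_inj; rewrite qform_opsum//.
apply/eqP; rewrite eq_le; apply/andP; split.
  have [c c0 hc] := qform_le_mass (R := R) v.
  apply/lee_addgt0Pr => e e0.
  (* A tail of mass below [e / (c + 1)] contributes at most [c * (e / (c + 1))], hence at most [e];
     adding 1 keeps the denominator positive when [c] is 0. *)
  have : ((mass (opsum D F) - e / (c + 1))%:E < \esum_(i in D) (mass (F i))%:E)%E.
    by rewrite -mass_opsum// lte_fin ltrBlDr ltrDl divr_gt0//; lra.
  move=> /ereal_sup_gt[_ [A [fA AD] <-]]; rewrite fsumEFin// lte_fin => hA.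
  rewrite (split_sum A v)// EFinD leeD//.
    by rewrite -fsumEFin//; apply: esum_ge; exists A.
  have pT := lowner_fsum_opsum sF (conj fA AD).
  rewrite lee_fin; apply: le_trans (hc _ (sc_psd hk s pT)) _.
  apply: (@le_trans _ _ (c * (e / (c + 1)))).
    rewrite ler_wpM2l//; apply: le_trans (sc_mass_le s hk pT) _.
    by rewrite massB mass_fsum//; move: hA; lra.
  rewrite mulrA ler_pdivrMr; last lra.
  nra.
apply: ge_ereal_sup => _ [A [fA AD] <-].
rewrite fsumEFin// lee_fin (split_sum A v)// lerDl.
by apply/qform_ge0/sc_psd => //; exact: lowner_fsum_opsum.
Qed.

Lemma esum_supp mu (a : state X -> \bar R) : (forall s, mu s = 0 -> a s = 0%E) ->
  (\esum_(s in supp mu) a s = \esum_(s in [set: state X]) a s)%E.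
Proof.
move=> a0; rewrite esum_mkcond; apply: eq_esum => s _; case: ifPn => //.
by move=> /negP; rewrite inE /supp/= => /negP; rewrite negbK => /eqP/a0.
Qed.

Definition subkernel K := forall s, subchannel (K s).

Section Extend.
Variables (K : state X -> op R V -> dist) (hK : subkernel K).

Lemma extend_summable mu s' : summable_psd setT mu ->
  summable_psd (supp mu) (fun s => K s (mu s) s').
Proof.
move=> [pmu mmu]; split=> [s _|]; first exact/sc_psd/pmu.
apply: le_lt_trans mmu; rewrite esum_supp; last first.
  by move=> s ->; rewrite sc0// mass0.
by apply: le_esum => s _; rewrite lee_fin sc_mass_le//; exact: pmu.
Qed.

Lemma psd_extend mu s' : summable_psd setT mu -> psd (extend K mu s').
Proof. by move=> smu; apply/psd_opsum/extend_summable. Qed.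

(** Summing over all states removes the dependence of the index set on [mu], so that sums for
    different distributions can be added and compared. *)
Lemma qform_extend mu s' v : summable_psd setT mu ->
  ((qform (extend K mu s') v)%:E =
    \esum_(s in [set: state X]) (qform (K s (mu s) s') v)%:E)%E.
Proof.
move=> smu; rewrite qform_opsum; last exact: extend_summable.
by rewrite esum_supp// => s ->; rewrite sc0// qform0.
Qed.

Lemma mass_extend mu s' : summable_psd setT mu ->
  ((mass (extend K mu s'))%:E =
    \esum_(s in [set: state X]) (mass (K s (mu s) s'))%:E)%E.
Proof.
move=> smu; rewrite mass_opsum; last exact: extend_summable.
by rewrite esum_supp// => s ->; rewrite sc0// mass0.
Qed.

(** Exchange the sums over final and initial states, then use the mass bound at each initial
    state. *)
Lemma extend_mass_le mu : summable_psd setT mu ->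
  (\esum_(s in [set: state X]) (mass (extend K mu s))%:E <=
   \esum_(s in [set: state X]) (mass (mu s))%:E)%E.
Proof.
move=> smu; have [pmu _] := smu.
under eq_esum do rewrite mass_extend//.
rewrite esum_exchange; last first.
  by move=> s s' _ _; rewrite lee_fin; apply/mass_ge0/sc_psd/pmu.
by apply: le_esum => s _; apply/sc_mass/pmu.
Qed.

Lemma summable_extend mu :
  summable_psd setT mu -> summable_psd setT (extend K mu).
Proof.
move=> smu; split=> [s _|]; first exact: psd_extend.
by apply: le_lt_trans (extend_mass_le smu) _; case: smu.
Qed.

Lemma extendD mu1 mu2 : summable_psd setT mu1 -> summable_psd setT mu2 ->
  extend K (fun s => mu1 s + mu2 s) = (fun s => extend K mu1 s + extend K mu2 s).
Proof.
move=> s1 s2; have [p1 _] := s1; have [p2 _] := s2.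
have s12 := summable_psdD s1 s2.
apply/funext => s'; apply: qform_inj.
- exact: psd_extend.
- by apply: psdD; exact: psd_extend.
move=> v; apply: EFin_inj; rewrite qformD EFinD !qform_extend// -esumD.
- by apply: eq_esum => s _; rewrite sc_add ?qformD//; [exact: p1|exact: p2].
- by move=> s _; rewrite lee_fin; apply/qform_ge0/sc_psd/p1.
- by move=> s _; rewrite lee_fin; apply/qform_ge0/sc_psd/p2.
Qed.

(** This serves commands that move nothing between classical states: skip, abort and the loop
    exit. *)
Lemma extend_diag mu s' : summable_psd setT mu ->
  (forall s, s != s' -> K s (mu s) s' = 0) -> extend K mu s' = K s' (mu s') s'.
Proof.
move=> smu h; have [pmu _] := smu.
have pK s : psd (K s (mu s) s') by apply/sc_psd/pmu.
apply: qform_inj => [||v] //; first exact: psd_extend.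
apply: EFin_inj; rewrite qform_extend// (esum_single (i0 := s'))//.
  by rewrite lee_fin qform_ge0.
by move=> s /h ->; rewrite qform0.
Qed.

Lemma subchannel_extend k :
  subchannel k -> subchannel (fun rho => extend K (k rho)).
Proof.
move=> hk; split.
- by move=> rho s prho; apply/psd_extend/sc_summable.
- move=> rho1 rho2 s p1 p2.
  rewrite (_ : k (rho1 + rho2) = fun s => k rho1 s + k rho2 s); last first.
    by apply/funext => s'; rewrite sc_add.
  by rewrite extendD//; exact: sc_summable.
- move=> rho prho; apply: le_trans (extend_mass_le (sc_summable hk prho)) _.
  exact: sc_mass.
Qed.

End Extend.

(** Associativity of Kleisli composition: [sc_opsum] moves [K2] inside the sum over initial states,
    and the two sums of nonnegative reals are then exchanged. *)
Lemma extend_extend K1 K2 mu :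
  subkernel K1 -> subkernel K2 -> summable_psd setT mu ->
  extend K2 (extend K1 mu) = extend (fun s rho => extend K2 (K1 s rho)) mu.
Proof.
move=> h1 h2 smu; have [pmu _] := smu.
have h12 : subkernel (fun s rho => extend K2 (K1 s rho)).
  by move=> s; exact: subchannel_extend.
have s1 := summable_extend h1 smu.
apply/funext => s''; apply: qform_inj; [exact: psd_extend..|move=> v].
apply: EFin_inj; rewrite !qform_extend//.
transitivity (\esum_(s' in [set: state X]) \esum_(s in [set: state X])
    (qform (K2 s' (K1 s (mu s) s') s'') v)%:E)%E.
  apply: eq_esum => s' _; have sE := extend_summable h1 s' smu.
  rewrite /extend sc_opsum// qform_opsum; last exact: sc_summable_opsum.
  by rewrite esum_supp// => s ->; rewrite (sc0 _ (h1 s)) sc0// qform0.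
rewrite esum_exchange; last first.
  move=> s' s _ _; rewrite lee_fin.
  exact/qform_ge0/(sc_psd (h2 _))/(sc_psd (h1 _))/pmu.
apply: eq_esum => s _; rewrite qform_extend//.
by apply: sc_summable => //; exact: pmu.
Qed.

End Subchannels.

(** * Limits of increasing sequences of positive operators *)

Section MonotoneLimits.
Variables (R : realType) (W : finType).
Implicit Type A : nat -> op R W.

(** Each form is nondecreasing and, by [qform_le_mass], bounded by a multiple of [M]; it therefore
    converges to its supremum, and [psd_cvg] applies. *)
Lemma lowner_cvg A (M : R) : (forall n, psd (A n)) ->
  (forall n, lowner (A n) (A n.+1)) -> (forall n, mass (A n) <= M) ->
  [/\ psd (lim (A n @[n --> \oo])),
      forall v, qform (A n) v @[n --> \oo] --> qform (lim (A n @[n --> \oo])) v &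
      forall n v, qform (A n) v <= qform (lim (A n @[n --> \oo])) v].
Proof.
move=> pA incA mA.
have ndA v : nondecreasing_seq (fun n => qform (A n) v).
  by apply/nondecreasing_seqP => n; exact: (proj1 (lownerP (pA n) (pA n.+1))).
have cA v : qform (A n) v @[n --> \oo] --> sup (range (fun n => qform (A n) v)).
  apply: nondecreasing_cvgn => //; have [c c0 hc] := qform_le_mass (R := R) v.
  exists (c * M) => _ [n _ <-]; apply: le_trans (hc _ (pA n)) _.
  by rewrite ler_wpM2l.
have [_ pL qL] := psd_cvg (F := \oo) _ (nearW _ pA) cA.
split=> // [v|n v]; rewrite qL//.
apply: (cvgr_to_ge (cA v)); exists n => // m /= nm.
exact: ndA.
Qed.

End MonotoneLimits.

(** * Increasing limits of subchannels *)

Section SubchannelLimits.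
Variables (R : realType) (V : finType) (X : eqType).
Local Notation dist := (state X -> op R V).

Lemma cvg_mass (T : Type) (F : set_system T) (FF : Filter F)
    (f : T -> op R V) (A : op R V) :
  (forall v, qform (f t) v @[t --> F] --> qform A v) ->
  mass (f t) @[t --> F] --> mass A.
Proof.
move=> fA; rewrite massE; under eq_cvg do rewrite massE.
by apply: (cvg_big (op := +%R)) => [|k _]; [exact: add_continuous|exact: fA].
Qed.

Lemma subchannel_lim (k_ : nat -> op R V -> dist) :
  (forall n, subchannel (k_ n)) ->
  (forall n rho s, psd rho -> lowner (k_ n rho s) (k_ n.+1 rho s)) ->
  subchannel (fun rho => dlim (fun n => k_ n rho)).
Proof.
move=> hk inck.
have L rho s (prho : psd rho) := lowner_cvg
  (fun n => sc_psd (hk n) s prho) (fun n => inck n rho s prho)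
  (fun n => sc_mass_le s (hk n) prho).
split=> [rho s /(L _ s)[]//|rho1 rho2 s p1 p2|rho prho].
  have [l1 c1 _] := L _ s p1; have [l2 c2 _] := L _ s p2.
  have [l12 c12 _] := L _ s (psdD p1 p2).
  apply: qform_inj; [exact: l12|exact: psdD l1 l2|move=> v; rewrite qformD].
  apply: (@cvg_unique _ (@norm_hausdorff _ _)
    (qform (k_ n (rho1 + rho2) s) v @[n --> \oo])).
    exact: c12.
  rewrite /=; under eq_cvg do rewrite sc_add// qformD.
  by apply: cvgD; [exact: c1|exact: c2].
(* The mass bound passes to the limit on each finite set of states, where the sum is continuous; the
   supremum over such sets is taken last. *)
apply: ge_ereal_sup => _ [A [fA _] <-].
rewrite fsumEFin// lee_fin fsbig_finite//=.
apply: (@cvgr_to_le _ \oo _ _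
  (fun n => \sum_(s <- finmap.enum_fset (fset_set A)) mass (k_ n rho s))).
  apply: (cvg_big (op := +%R)) => [|s _]; first exact: add_continuous.
  by apply: cvg_mass => v; have [_ + _] := L _ s prho; exact.
apply: nearW => n; rewrite -fsbig_finite// -lee_fin -fsumEFin//.
by apply: le_trans (sc_mass (hk n) prho); apply: esum_ge; exists A.
Qed.

(** Monotone convergence. Any finite set of initial states commutes with the limit, which bounds the
    left side by the right; conversely each approximation lies termwise below its limit. *)
Lemma extend_dlim (K_ : nat -> state X -> op R V -> dist) (mu : dist) :
  (forall n, subkernel (K_ n)) ->
  (forall n s rho s', psd rho -> lowner (K_ n s rho s') (K_ n.+1 s rho s')) ->
  summable_psd setT mu ->
  extend (fun s rho => dlim (fun n => K_ n s rho)) mu =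
  dlim (fun n => extend (K_ n) mu).
Proof.
move=> hK incK smu; have [pmu mmu] := smu.
have hL : subkernel (fun s rho => dlim (fun n => K_ n s rho)).
  by move=> s; apply: subchannel_lim => [n|n rho s']; [exact: hK|exact: incK].
have L s s' := lowner_cvg
  (fun n => sc_psd (hK n s) s' (pmu s I)) (fun n => incK n s _ s' (pmu s I))
  (fun n => sc_mass_le s' (hK n s) (pmu s I)).
apply/funext => s'.
have [||pE cE leE] := @lowner_cvg _ _ (fun n => extend (K_ n) mu s')
  (fine (\esum_(s in [set: state X]) (mass (mu s))%:E))
  (fun n => psd_extend (hK n) s' smu).
- move=> n /=; apply: (proj2 (lownerP (psd_extend (hK n) s' smu)
    (psd_extend (hK n.+1) s' smu))) => v.
  rewrite -lee_fin !(qform_extend (hK _) _ _ smu).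
  apply: le_esum => s _; rewrite lee_fin.
  apply: (proj1 (lownerP _ _)); [exact/(sc_psd (hK _ _))/pmu..|].
  exact/incK/pmu.
- move=> n; rewrite -lee_fin fineK; last first.
    rewrite ge0_fin_numE//; apply: esum_ge0 => s _.
    by rewrite lee_fin; apply/mass_ge0/pmu.
  apply: le_trans (extend_mass_le (hK n) smu).
  exact: (le_esum_term (fun s => (mass (extend (K_ n) mu s))%:E)).
apply: qform_inj; [exact: (psd_extend hL _ smu)|exact: pE|move=> v].
apply: EFin_inj; apply/eqP; rewrite eq_le; apply/andP; split.
  rewrite (qform_extend hL _ _ smu); apply: ge_ereal_sup => _ [A [fA _] <-].
  rewrite fsumEFin// lee_fin fsbig_finite//=.
  apply: (@cvgr_to_le _ \oo _ _ (fun n =>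
      \sum_(s <- finmap.enum_fset (fset_set A)) qform (K_ n s (mu s) s') v)).
    apply: (cvg_big (op := +%R)) => [|s _]; first exact: add_continuous.
    by have [_ + _] := L s s'; exact.
  apply: nearW => n; apply: le_trans (leE n v).
  rewrite -fsbig_finite// -lee_fin -fsumEFin// (qform_extend (hK n) _ _ smu).
  by apply: esum_ge; exists A.
rewrite lee_fin; apply: (cvgr_to_le (cE v)); apply: nearW => n.
rewrite -lee_fin (qform_extend (hK n) _ _ smu) (qform_extend hL _ _ smu).
apply: le_esum => s _.
by rewrite lee_fin; have [_ _ +] := L s s'; exact.
Qed.

End SubchannelLimits.

(** * Embedding operators on selected qubits is a unital *-homomorphism *)

Section Embed.
Variables (R : realType) (W : finType) (k : nat) (q : k.-tuple W).
Implicit Types (A B : op R 'I_k) (i j m : 'I_(qdim W)) (p : 'I_(qdim 'I_k)).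

Definition eq_off i j := [forall w, (w \notin q) ==> (ket i w == ket j w)].

Definition restr i : 'I_(qdim 'I_k) := enum_rank [ffun l => ket i (tnth q l)].

(** For distinct qubits, [glue i] and [restr] are inverse bijections between the indices [p] and the
    indices agreeing with [i] off [q]. *)
Definition glue i p : 'I_(qdim W) := enum_rank
  [ffun w => if [pick l | tnth q l == w] is Some l then ket p l else ket i w].

Lemma embedE A i j :
  embed q A i j = if eq_off i j then A (restr i) (restr j) else 0.
Proof. by rewrite mxE. Qed.

Lemma eq_offP i j :
  reflect (forall w, w \notin q -> ket i w = ket j w) (eq_off i j).
Proof.
apply: (iffP forallP) => [h w wq|h w]; first by have := h w; rewrite wq => /eqP.
by apply/implyP => /h ->.
Qed.

Lemma eq_off_refl i : eq_off i i.
Proof. exact/eq_offP. Qed.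

Lemma eq_off_sym i j : eq_off i j = eq_off j i.
Proof. by apply/eq_offP/eq_offP => h w wq; rewrite h. Qed.

Lemma eq_off_trans i j m : eq_off i j -> eq_off i m = eq_off j m.
Proof.
move=> /eq_offP ij; apply/eq_offP/eq_offP => h w wq; first by rewrite -ij// h.
by rewrite ij// h.
Qed.

Lemma ket_enum_rank (U : finType) (f : {ffun U -> bool}) :
  ket (enum_rank f : 'I_(qdim U)) = f.
Proof. exact: enum_rankK. Qed.

Lemma ket_inj (U : finType) : injective (@ket U).
Proof. exact: enum_val_inj. Qed.

Lemma eq_off_glue i p : eq_off i (glue i p).
Proof.
apply/eq_offP => w wq; rewrite ket_enum_rank ffunE.
by case: pickP => // l /eqP lw; rewrite -lw mem_tnth in wq.
Qed.

Lemma glueK i p : uniq q -> restr (glue i p) = p.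
Proof.
move=> /tuple_uniqP uq; apply: ket_inj; apply/ffunP => l.
rewrite !ket_enum_rank !ffunE; case: pickP => [l' /eqP/uq ->//|/(_ l)].
by rewrite eqxx.
Qed.

Lemma restrK i m : eq_off i m -> glue i (restr m) = m.
Proof.
move=> /eq_offP im; apply: ket_inj; apply/ffunP => w.
rewrite !ket_enum_rank !ffunE; case: pickP => [l /eqP <-|h].
  by rewrite ffunE.
by apply: im; apply/negP => /tnthP[l wl]; have := h l; rewrite wl eqxx.
Qed.

(** Only intermediate indices agreeing with [i] off [q] contribute to the product of embeddings;
    reindexing them by [glue i] yields the product of the small matrices. *)
Lemma embedM A B : uniq q -> embed q (A *m B) = embed q A *m embed q B.
Proof.
move=> uq; apply/matrixP => i j; rewrite embedE mxE [RHS]mxE.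
under [RHS]eq_bigr do rewrite !embedE.
(* If [i] and [j] differ off [q], each intermediate index differs from one of them there, so every
   term vanishes. *)
case: ifPn => [ij|nij]; last first.
  rewrite big1// => m _; case: ifPn; rewrite ?mul0r// => im.
  by rewrite -(eq_off_trans _ im) (negPf nij) mulr0.
rewrite (bigID (eq_off i))/= [X in _ + X]big1 ?addr0; last first.
  by move=> m /negPf ->; rewrite mul0r.
rewrite (reindex_onto (glue i) restr)/=; last by move=> m; exact: restrK.
apply: eq_big => [p|p _]; first by rewrite eq_off_glue glueK// eqxx.
by rewrite eq_off_glue glueK// -(eq_off_trans _ (eq_off_glue i p)) ij.
Qed.

Lemma embed_adj A : embed q (A^t*) = (embed q A)^t*.
Proof.
apply/matrixP => i j; rewrite embedE [RHS]mxE [in RHS]mxE embedE eq_off_sym.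
by case: ifP => _; rewrite ?rmorph0// !mxE.
Qed.

Lemma embed1 : embed q (1%:M : op R 'I_k) = 1%:M.
Proof.
apply/matrixP => i j; rewrite embedE !mxE.
have [->|nij] := eqVneq i j; first by rewrite eq_off_refl eqxx.
case: ifPn => // ij; case: eqVneq => // rij.
by case/eqP: nij; rewrite -(restrK (eq_off_refl i)) rij restrK.
Qed.

Lemma embedD A B : embed q (A + B) = embed q A + embed q B.
Proof.
apply/matrixP => i j; rewrite [RHS]mxE !embedE.
by case: ifP; rewrite ?addr0// mxE.
Qed.

Lemma embed0 : embed q (0 : op R 'I_k) = 0.
Proof. by apply/matrixP => i j; rewrite embedE !mxE; case: ifP. Qed.

Lemma cvg_embed (T : Type) (F : set_system T) (FF : Filter F)
    (f : T -> op R 'I_k) A :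
  f @ F --> A -> embed q (f t) @[t --> F] --> embed q A.
Proof.
move=> /cvg_mxP fA; apply/cvg_mxP => i j; rewrite embedE.
under eq_cvg do rewrite embedE.
by case: ifP => _; [exact: fA|exact: cvg_cst].
Qed.

End Embed.

(** * The primitive commands are subchannels *)

Section Instructions.
Variables (R : realType) (V : finType) (X : eqType).
Local Notation dist := (state X -> op R V).

(** Cyclicity of the trace reduces mass bounds to the operator [E^t* *m E]. *)
Lemma mass_congr (E rho : op R V) :
  mass (E *m rho *m E^t*) = mass (E^t* *m E *m rho).
Proof. by rewrite /mass mxtrace_mulC mulmxA. Qed.

Lemma cvg_mass_mulmxr (T : Type) (F : set_system T) (FF : Filter F)
    (f : T -> op R V) (A rho : op R V) : f @ F --> A ->
  mass (f t *m rho) @[t --> F] --> mass (A *m rho).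
Proof.
move=> /cvg_mxP fA; apply: cvg_Re; rewrite /mxtrace.
apply: (cvg_big (op := +%R)) => [|i _]; first exact: add_continuous.
rewrite mxE; under eq_cvg do rewrite mxE.
apply: (cvg_big (op := +%R)) => [|l _]; first exact: add_continuous.
by apply: cvgM; [exact: fA|exact: cvg_cst].
Qed.

Lemma subchannel_dpoint (s0 : state X) (f : op R V -> op R V) :
  (forall rho, psd rho -> psd (f rho)) -> {morph f : A B / A + B} ->
  (forall rho, psd rho -> mass (f rho) <= mass rho) ->
  subchannel (fun rho => dpoint s0 (f rho)).
Proof.
move=> pf fD mf; split=> [rho s prho|rho1 rho2 s _ _|rho prho]; rewrite /dpoint.
- by case: ifP => _; [exact: pf|exact: psd0].
- by case: ifP; rewrite ?addr0.
rewrite (esum_single (i0 := s0))//.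
- by rewrite eqxx lee_fin mf.
- by rewrite eqxx lee_fin; apply/mass_ge0/pf.
- by move=> s /negPf ->; rewrite mass0.
Qed.

Lemma subchannel0 : subchannel (fun=> @dzero R V X).
Proof.
split=> [rho s _|rho1 rho2 s _ _|rho prho]; rewrite /dzero.
- exact: psd0.
- by rewrite addr0.
- by rewrite esum1 ?lee_fin ?mass_ge0// => s _; rewrite mass0.
Qed.

Lemma eq_ket1 (i j : 'I_(qdim 'I_1)) : (i == j) = (ket i ord0 == ket j ord0).
Proof.
apply/eqP/eqP => [->//|ij]; apply: ket_inj; apply/ffunP => l.
by rewrite (ord1 l).
Qed.

Lemma ketbra_adj a b : (ketbra R a b)^t* = ketbra R b a.
Proof. by apply/matrixP => i j; rewrite !mxE rmorph_nat andbC. Qed.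

Lemma ketbraM a b c : ketbra R a b *m ketbra R b c = ketbra R a c.
Proof.
apply/matrixP => i j; rewrite !mxE.
rewrite (bigD1 (enum_rank [ffun=> b]))//= [X in _ + X]big1 ?addr0.
  by rewrite !mxE ket_enum_rank ffunE eqxx andbT/= -natrM mulnb.
move=> m; rewrite eq_ket1 ket_enum_rank ffunE => /negPf mb.
by rewrite !mxE mb andbF mul0r.
Qed.

Lemma ketbraD : ketbra R false false + ketbra R true true = 1%:M.
Proof.
apply/matrixP => i j; rewrite !mxE eq_ket1.
by case: (ket i _) (ket j _) => [] []; rewrite ?addr0 ?add0r.
Qed.

Lemma subchannel_qinit (s : state X) (q : V) :
  subchannel (sem_at (QInit R X q) s).
Proof.
rewrite /=.
have K_adj a b : embed [tuple q] (ketbra R a b)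
    = (embed [tuple q] (ketbra R b a))^t*.
  by rewrite -embed_adj ketbra_adj.
apply: subchannel_dpoint => [rho prho|rho1 rho2|rho prho].
- apply: psdD; rewrite [X in _ *m X]K_adj; exact: psd_congr.
- by rewrite !mulmxDr !mulmxDl addrACA.
(* The two Kraus operators satisfy the completeness relation |0><0| + |1><1| = 1, so mass is
   preserved. *)
rewrite massD [X in mass (_ *m X) + _]K_adj [X in _ + mass (_ *m X)]K_adj.
rewrite !mass_congr -massD -mulmxDl -!embed_adj -!embedM// -embedD.
rewrite (_ : _ + _ = 1%:M) ?embed1 ?mul1mx//.
by rewrite !ketbra_adj !ketbraM ketbraD.
Qed.

Lemma subchannel_qunit (s : state X) k (q : k.-tuple V) (uq : uniq q)
    (U : op R 'I_k) (hU : U \is unitarymx) :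
  subchannel (sem_at (QUnit X uq hU) s).
Proof.
rewrite /=; apply: subchannel_dpoint => [rho|rho1 rho2|rho prho].
- exact: psd_congr.
- by rewrite mulmxDr mulmxDl.
have UU : U^t* *m U = 1%:M.
  by apply: mulmx1C; apply/unitarymxP.
by rewrite mass_congr -embed_adj -embedM// UU embed1 mul1mx.
Qed.

(** Completeness holds only in the limit: the mass collected by a finite set of outcomes is at most
    that of every larger finite set, and these masses tend to [mass rho]. *)
Lemma measurement_mass_le k (q : k.-tuple V) (uq : uniq q)
    (M : measurement R k) rho : psd rho ->
  (\esum_(i in outcomes M)
     (mass (embed q (mop M i) *m rho *m (embed q (mop M i))^t*))%:E
   <= (mass rho)%:E)%E.
Proof.
move=> prho; apply: ge_ereal_sup => _ [A [fA AD] <-]; rewrite fsumEFin// lee_fin.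
have FF := fsets_filter_proper (outcomes M).
have := cvg_mass_mulmxr (rho := rho) _
  (cvg_embed (q := q) _ (@mop_complete _ _ M)).
rewrite embed1 mul1mx => /(_ _ _)/cvgr_to_ge; apply.
exists A => // B [[fB BD] AB].
rewrite [leRHS](_ : _ = \sum_(i \in B)
  mass (embed q (mop M i) *m rho *m (embed q (mop M i))^t*)).
  rewrite -lee_fin -!fsumEFin//; apply: lee_fsum_nneg_subset => //.
    exact/subsetP.
  by move=> i _; rewrite lee_fin; apply/mass_ge0/psd_congr.
rewrite !fsbig_finite//=.
rewrite (big_morph (fun N => mass (embed q N *m rho)) (id1 := 0) (op1 := +%R)).
- by apply: eq_bigr => i _; rewrite [RHS]mass_congr (embedM _ _ uq) embed_adj.
- by move=> N N'; rewrite embedD mulmxDl massD.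
- by rewrite embed0 mul0mx mass0.
Qed.

Lemma subchannel_qmeas (s : state X) (x : X) k (q : k.-tuple V) (uq : uniq q)
    (M : measurement R k) :
  subchannel (sem_at (QMeas x uq M) s).
Proof.
have sE rho s' : psd rho ->
    summable_psd [set i | outcomes M i /\ update s x i = s']
      (fun i => embed q (mop M i) *m rho *m (embed q (mop M i))^t*).
  move=> prho; split=> [i _|]; first exact: psd_congr.
  apply: le_lt_trans (_ : (mass rho)%:E < +oo)%E; last by rewrite ltry.
  apply: le_trans (measurement_mass_le uq M prho).
  by apply: le_esum_subset => i [].
rewrite /=; split=> [rho s' /(sE _ s') /psd_opsum//|rho1 rho2 s' p1 p2|rho prho].
  rewrite -opsumD; [|exact: sE..].
  by congr opsum; apply/funext => i; rewrite mulmxDr mulmxDl.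
apply: le_trans (measurement_mass_le uq M prho).
under eq_esum => s' _.
  rewrite mass_opsum; last exact: sE.
  rewrite (_ : [set i | _] = outcomes M `&` [set i | update s x i = s'])//.
  rewrite esum_mkcondr; over.
have m0 i :
    (0 <= (mass (embed q (mop M i) *m rho *m (embed q (mop M i))^t*))%:E)%E.
  by rewrite lee_fin; apply/mass_ge0/psd_congr.
(* With the outcomes on the outside, each one leads to the single final state [update s x i], so it
   is counted once. *)
rewrite esum_exchange; last by move=> s' i _ _; case: ifP.
apply: le_esum => i _; rewrite (esum_single (i0 := update s x i))//.
- by rewrite mem_set.
- by case: ifP.
- by move=> s' ns; rewrite memNset//= => /esym/eqP; rewrite (negPf ns).
Qed.

End Instructions.

(** * Semantics of commands on distributions *)

Section Soundness.
Variables (R : realType) (V : finType) (X : eqType).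
Local Notation dist := (state X -> op R V).
Local Notation cmd := (cmd R V X).
Implicit Types (b : bexp X) (c : cmd) (mu nu : dist).

Lemma subkernel_if b c0 c1 : subkernel (sem_at c0) -> subkernel (sem_at c1) ->
  subkernel (sem_at (If b c0 c1)).
Proof. by move=> h0 h1 s /=; case: (beval b s); [exact: h0|exact: h1]. Qed.

Lemma subkernel_skip : subkernel (sem_at (Skip R V X)).
Proof. by move=> s /=; exact: (subchannel_dpoint s (f := id)). Qed.

Lemma subkernel_seq c0 c1 : subkernel (sem_at c0) -> subkernel (sem_at c1) ->
  subkernel (sem_at (Seq c0 c1)).
Proof. by move=> h0 h1 s /=; exact: subchannel_extend. Qed.

Lemma subkernel_pow c n : subkernel (sem_at c) -> subkernel (sem_at (cpow c n)).
Proof.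
move=> hc; elim: n => [|n IHn] /=; first exact: subkernel_skip.
exact: subkernel_seq.
Qed.

Lemma subkernel_exit b : subkernel (sem_at (if_then b (Abort R V X))).
Proof.
by apply: subkernel_if; [move=> s; exact: subchannel0|exact: subkernel_skip].
Qed.

Lemma sem_exit b nu s : summable_psd setT nu ->
  sem (if_then b (Abort R V X)) nu s = if beval b s then 0 else nu s.
Proof.
move=> snu; rewrite /sem (extend_diag (subkernel_exit b) snu) => [|s' ss] /=.
  by case: ifP => //= _; rewrite /dpoint eqxx.
by case: ifP => //= _; rewrite /dpoint eq_sym (negPf ss).
Qed.

(** Where the guard fails, one more round of [if_then b c] acts as skip, so what has already left
    the loop stays and further mass can only be added. *)
Lemma exit_increasing b c nu s : subkernel (sem_at c) -> summable_psd setT nu ->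
  lowner (sem (if_then b (Abort R V X)) nu s)
    (sem (if_then b (Abort R V X)) (sem (if_then b c) nu) s).
Proof.
move=> hc snu; have [pnu _] := snu.
have hB : subkernel (sem_at (if_then b c)).
  exact/(subkernel_if b hc)/subkernel_skip.
have sB : summable_psd setT (sem (if_then b c) nu) := summable_extend hB snu.
rewrite (sem_exit b s snu) (sem_exit b s sB); case: ifPn => [_|nb].
  by rewrite /lowner subrr; exact: psd0.
apply: (proj2 (lownerP (pnu s I) (psd_extend hB s snu))) => v.
rewrite -lee_fin (qform_extend hB s v snu).
(* The term with initial state [s] alone is already the form of [nu s]. *)
apply: le_trans (le_esum_term
  (fun s' => (qform (sem_at (if_then b c) s' (nu s') s) v)%:E) (i0 := s) I).
by rewrite /= (negPf nb) /dpoint eqxx.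
Qed.

(** Since [cpow] appends the new iteration at the end, this is [exit_increasing] at the distribution
    reached after [n] rounds. *)
Lemma loop_increasing b c n s rho s' : subkernel (sem_at c) -> psd rho ->
  lowner (sem_at (Seq (cpow (if_then b c) n) (if_then b (Abort R V X))) s rho s')
   (sem_at (Seq (cpow (if_then b c) n.+1) (if_then b (Abort R V X))) s rho s').
Proof.
move=> hc prho; apply: (exit_increasing b s' hc); apply: sc_summable prho.
exact/subkernel_pow/(subkernel_if b hc)/subkernel_skip.
Qed.

Lemma subkernel_unroll b c n : subkernel (sem_at c) ->
  subkernel (sem_at (Seq (cpow (if_then b c) n) (if_then b (Abort R V X)))).
Proof.
move=> hc; apply: subkernel_seq; last exact: subkernel_exit.
exact/subkernel_pow/(subkernel_if b hc)/subkernel_skip.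
Qed.

Lemma subkernel_sem c : subkernel (sem_at c).
Proof.
elim: c => [|||c0 h0 c1 h1|b c0 h0 c1 h1|b c hc|q|k q uq U hU|x k q uq M].
- exact: subkernel_skip.
- by move=> s; exact: subchannel0.
- by move=> x a s /=; exact: (subchannel_dpoint _ (f := id)).
- exact: subkernel_seq.
- exact: subkernel_if.
- move=> s; rewrite (_ : sem_at _ s = fun rho => dlim (fun n =>
    sem_at (Seq (cpow (if_then b c) n) (if_then b (Abort R V X))) s rho)).
    apply: subchannel_lim => [n|n rho s' prho]; first exact: subkernel_unroll.
    exact: loop_increasing.
  by apply/funext => rho; rewrite sem_atW.
- by move=> s; exact: subchannel_qinit.
- by move=> s; exact: subchannel_qunit.
- by move=> s; exact: subchannel_qmeas.
Qed.

Lemma summable_povd mu : is_povd mu -> summable_psd setT mu.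
Proof.
by move=> [pmu mmu]; split=> [s _//|]; apply: le_lt_trans mmu _; rewrite ltry.
Qed.

Lemma is_povd_sem c mu : is_povd mu -> is_povd (sem c mu).
Proof.
move=> hmu; have smu := summable_povd hmu; split=> [s|].
  exact: (psd_extend (subkernel_sem c)).
apply: le_trans (proj2 hmu); exact: (extend_mass_le (subkernel_sem c)).
Qed.

Lemma sem_skip mu : is_povd mu -> sem (Skip R V X) mu = mu.
Proof.
move=> hmu; apply/funext => s; have smu := summable_povd hmu.
rewrite /sem (extend_diag subkernel_skip smu) /= /dpoint ?eqxx// => s' ss.
by rewrite eq_sym (negPf ss).
Qed.

Lemma sem_abort mu : is_povd mu -> sem (Abort R V X) mu = @dzero R V X.
Proof.
move=> hmu; apply/funext => s.
exact: (extend_diag (subkernel_sem (Abort R V X)) (summable_povd hmu)).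
Qed.

Lemma sem_seq c0 c1 mu : is_povd mu -> sem (Seq c0 c1) mu = sem c1 (sem c0 mu).
Proof.
move=> hmu; rewrite /sem (extend_extend (subkernel_sem c0) (subkernel_sem c1))//.
exact: summable_povd.
Qed.

Lemma semD c mu1 mu2 : is_povd mu1 -> is_povd mu2 ->
  sem c (fun s => mu1 s + mu2 s) = (fun s => sem c mu1 s + sem c mu2 s).
Proof.
by move=> h1 h2; apply: (extendD (subkernel_sem c)); exact: summable_povd.
Qed.

(** Used to resolve a conditional whose guard is decided only on the support of [mu]. *)
Lemma eq_sem_supp c c' mu : is_povd mu ->
  (forall s, mu s != 0 -> sem_at c s = sem_at c' s) -> sem c mu = sem c' mu.
Proof.
move=> hmu cc'; have smu := summable_povd hmu; apply/funext => s'.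
apply: qform_inj; [exact: (psd_extend (subkernel_sem _))..|move=> v].
apply: EFin_inj; rewrite (qform_extend (subkernel_sem c) _ _ smu).
rewrite (qform_extend (subkernel_sem c') _ _ smu).
apply: eq_esum => s _; have [->|ms] := eqVneq (mu s) 0.
  by rewrite (sc0 _ (subkernel_sem c _)) (sc0 _ (subkernel_sem c' _)).
by rewrite cc'.
Qed.

Lemma sem_if_true b c0 c1 mu : is_povd mu -> supp mu `<=` beval b ->
  sem (If b c0 c1) mu = sem c0 mu.
Proof.
move=> hmu hb; apply: eq_sem_supp => // s ms.
by apply/funext => rho; rewrite /= (hb s ms).
Qed.

Lemma sem_if_false b c0 c1 mu : is_povd mu -> supp mu `<=` beval (BNot b) ->
  sem (If b c0 c1) mu = sem c1 mu.
Proof.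
move=> hmu hb; apply: eq_sem_supp => // s ms.
by apply/funext => rho; have := hb s ms; rewrite /= => /negPf ->.
Qed.

(** Loops are defined as limits at each initial state; [extend_dlim] takes the limit out of the sum
    over initial states. *)
Lemma sem_while b c mu : is_povd mu ->
  sem (While b c) mu =
  dlim (fun n => sem (if_then b (Abort R V X)) (sem (cpow (if_then b c) n) mu)).
Proof.
move=> hmu; rewrite (_ : (fun n => _) = fun n =>
  sem (Seq (cpow (if_then b c) n) (if_then b (Abort R V X))) mu); last first.
  by apply/funext => n; rewrite sem_seq.
rewrite [LHS]/sem (_ : sem_at (While b c) = fun s rho => dlim (fun n =>
  sem_at (Seq (cpow (if_then b c) n) (if_then b (Abort R V X))) s rho));
  last first.
  by apply/funext => s; apply/funext => rho; rewrite sem_atW.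
apply: (extend_dlim (K_ := fun n =>
  sem_at (Seq (cpow (if_then b c) n) (if_then b (Abort R V X))))).
- move=> n; exact: (subkernel_unroll b n (subkernel_sem c)).
- move=> n s rho s' prho.
  exact: (loop_increasing b n s s' (subkernel_sem c) prho).
- exact: summable_povd.
Qed.

Lemma lim_const_mx (M : op R V) : lim ((fun=> M) n @[n --> \oo]) = M.
Proof.
apply: cvg_lim; last exact: cvg_cst.
apply: mx_hausdorff; exact: norm_hausdorff.
Qed.

(** Membership in an assertion can thus be transported whatever proof of [is_povd] is attached. *)
Lemma povd_eq (mu nu : povd R V X) : (mu : dist) = nu -> mu = nu.
Proof.
case: mu nu => [mu hmu] [nu hnu] /= e; subst nu.
by rewrite (Prop_irrelevance hmu hnu).
Qed.

End Soundness.

(** * Induction on derivations *)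

Theorem mainTheorem3 (R : realType) (V : finType) (X : eqType)
    (P P' : assertion R V X) (c : cmd R V X) :
  derivable P c P' -> valid P c P'.
Proof.
elim=> {P P' c}.
- move=> P mu Pmu; rewrite (sem_skip (povdP mu)); exists (povdP mu).
  by rewrite (_ : Povd _ = mu)//; exact: povd_eq.
- move=> P mu _; exists (is_povd_sem (Abort R V X) (povdP mu)) => s.
  by rewrite /supp/= (sem_abort (povdP mu)) /dzero eqxx.
- by move=> P x a mu.
- move=> P0 P1 P2 c0 c1 _ v0 _ v1 mu /v0[h0 /v1].
  by rewrite (sem_seq _ _ (povdP mu)).
- move=> P0 P0' P1 P1' c _ v0 _ v1 mu [mu0 [mu1 [/v0[h0 P0m] /v1[h1 P1m] e]]].
  exists (is_povd_sem c (povdP mu)); exists (Povd h0), (Povd h1); split=> //= s.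
  have -> : (mu : state X -> op R V) = fun s => mu0 s + mu1 s by exact/funext.
  by rewrite (semD _ (povdP mu0) (povdP mu1)).
- move=> P0 P0' P1 P1' b c0 c1 _ v0 _ v1 mu [mu0 [mu1 [Pm0 Pm1 e]]].
  have [_ b0] := Pm0; have [_ b1] := Pm1.
  have [h0 P0m] := v0 _ Pm0; have [h1 P1m] := v1 _ Pm1.
  exists (is_povd_sem (If b c0 c1) (povdP mu)).
  exists (Povd h0), (Povd h1); split=> //= s.
  have -> : (mu : state X -> op R V) = fun s => mu0 s + mu1 s by exact/funext.
  (* Additivity separates the two summands, and the guard is constant on the support of each. *)
  rewrite (semD _ (povdP mu0) (povdP mu1)).
  by rewrite (sem_if_true _ _ (povdP mu0) b0) (sem_if_false _ _ (povdP mu1) b1).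
- by move=> c P mu [].
- move=> P0 P1 P2 P3 c P01 _ v P23 mu /P01/v[h P2m]; exists h; exact: P23.
(* The premise indexed by [mu] itself suffices. *)
- by move=> P P' c _ v mu Pmu; exact: (v mu).
- move=> P P' Poo' b c uc _ vB _ vE mu Pmu.
  pose B := if_then b c; pose E := if_then b (Abort R V X).
  have iter_sat n : sat (sem (cpow B n) mu) (P n).
    elim: n => [|n [h Pn]] /=.
      rewrite (sem_skip (povdP mu)); exists (povdP mu).
      by rewrite (_ : Povd _ = mu)//; exact: povd_eq.
    by rewrite (sem_seq _ _ (povdP mu)); exact: (vB n (Povd h) Pn).
  have exit_sat n : sat (sem E (sem (cpow B n) mu)) (P' n).
    by have [h Pn] := iter_sat n; exact: (vE n (Povd h) Pn).
  (* The outputs of the truncated loops increase and satisfy [P' n], so u-closedness places their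
     limit in [Poo']. *)
  pose xi n := Povd (is_povd_sem E (is_povd_sem (cpow B n) (povdP mu))).
  have [||h Ph] := uc xi.
  + move=> n s; rewrite /xi/= (sem_seq _ _ (povdP mu)).
    apply: exit_increasing; first exact: subkernel_sem.
    exact/summable_povd/is_povd_sem/povdP.
  + move=> n; have [h Ph] := exit_sat n.
    by rewrite (_ : xi n = Povd h)//; exact: povd_eq.
  rewrite (sem_while _ _ (povdP mu)); exists h; split=> // s.
  (* At a state where the guard holds every truncation is zero, hence so is the limit. *)
  rewrite /supp/=; apply: contraNN => bs; rewrite /dlim.
  rewrite (_ : (fun n => _) = fun=> 0) ?lim_const_mx//.
  apply/funext => n; rewrite sem_exit ?bs//.
  exact/summable_povd/is_povd_sem/povdP.
- by move=> P q mu.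
- by move=> P k q uq U hU mu.
- by move=> P x k q uq M mu.
Qed.
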